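(* Let $q\in(0,1)$ be fixed, and for each dimension $p$ let the sample size be $n=p/q$ (so $p/n=q$). For each integer $p\ge 1$ let $\lambda_{1,p}\ge\lambda_{2,p}\ge\dots\ge\lambda_{p,p}>0$ be the eigenvalues of the true covariance matrix $\Sigma_p$, and let $l_{1,p}\ge l_{2,p}\ge\dots\ge l_{p,p}$ be the eigenvalues of the corresponding sample covariance matrix $S_p$ computed from $n$ normal observations. For a positive integer $p$ and a positive real number $\kappa$ define $$H_{p,\kappa}=\Big\{i\in\{1,\dots,p\} : \text{for all integers } m\ge p,\ \Big|\frac{\lambda_{m,m}}{\lambda_{i,m}}-1\Big|<\frac{\kappa}{\sqrt m}\Big\},\qquad \xi(\kappa,p)=|H_{p,\kappa}|.$$ Then for every $0<\kappa<\sqrt{2/\pi}$ there exists $c_\kappa>0$ such that $$\liminf_{p\to\infty}\mathbb{P}(l_{p,p}\le\lambda_{p,p})\ \ge\ 1-\limsup_{p\to\infty}e^{-c_\kappa\,\xi(\kappa,p)}.$$ As a result, for every $0<\kappa<\sqrt{2/\pi}$, $$\lim_{p\to\infty}\xi(\kappa,p)=\infty\ \Longrightarrow\ \lim_{p\to\infty}\mathbb{P}(l_{p,p}\le\lambda_{p,p})=1.$$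
   Context: For each $p$, $\Sigma_p$ is a symmetric positive definite $p\times p$ real matrix, and $X_1,\dots,X_n$ are independent random vectors in $\mathbb{R}^p$ with the normal distribution $N(\mu,\Sigma_p)$ (for some mean $\mu$). The sample covariance matrix is $S_p=\frac1n\sum_{i=1}^n (X_i-\bar X)(X_i-\bar X)^t$ with $\bar X=\frac1n\sum_{i=1}^n X_i$; thus $S_p$ has the Wishart distribution $W_p(n-1,\frac1n\Sigma_p)$. Since $q=p/n$ is fixed, limits as $p\to\infty$ of probabilities involving $S_p$ are taken along those $p$ for which $n=p/q$ is an integer. *)

(* Defs.v *)
From HB Require Import structures.
From mathcomp Require Export all_boot all_order all_algebra.
From mathcomp Require Export all_classical all_reals all_analysis.

Set Implicit Arguments.
Unset Strict Implicit.
Unset Printing Implicit Defensive.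

Export Order.TTheory GRing.Theory Num.Theory.
Export numFieldNormedType.Exports.

#[global] Open Scope classical_set_scope.
#[global] Open Scope ring_scope.

Definition posdef (R : realType) p (A : 'M[R]_p) : Prop :=
  A^T = A /\ forall v : 'cV[R]_p, v != 0 -> 0 < (v^T *m A *m v) 0 0.

(* [s] lists the eigenvalues of [A], with algebraic multiplicity, in
   nonincreasing order. At most one [s] satisfies this, and exactly one does
   when [A] is symmetric. *)
Definition is_spectrum (R : realType) p (A : 'M[R]_p) (s : seq R) : Prop :=
  sorted >=%R s /\ char_poly A = \prod_(a <- s) ('X - a%:P).

(* Since some of the [B i] may be the whole space, the product rule for the
   whole family contains the one for each subfamily. *)
Definition mutually_independent (R : realType) d (T : measurableType d)
    (P : probability T R) d' (U : measurableType d') (I : finType)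
    (X : I -> {RV P >-> U}) : Prop :=
  forall B : I -> set U, (forall i, measurable (B i)) ->
    P (\bigcap_i (X i @^-1` B i)) = (\prod_i P (X i @^-1` B i))%E.

Definition colvec (R : realType) p (x : p.-tuple R) : 'cV[R]_p :=
  \col_j tnth x j.

(* The normal law N(mu, Sigma), for Sigma positive definite: the random vector
   is mu + Sigma^(1/2) Z, where the components of Z are independent and standard
   normal. [A] is the symmetric positive definite square root of Sigma, which is
   unique and invertible, so that Z = A^-1 (X - mu) lives on the same space. *)
Definition is_normal_vector (R : realType) d (T : measurableType d)
    (P : probability T R) p (mu : 'cV[R]_p) (Sigma : 'M[R]_p)
    (X : {RV P >-> p.-tuple R}) : Prop :=
  exists (A : 'M[R]_p) (Z : 'I_p -> {RV P >-> R}),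
    [/\ posdef A /\ A *m A = Sigma,
        mutually_independent Z,
        forall j (B : set R), measurable B ->
          distribution P (Z j) B = normal_prob 0 1 B
      & forall w, colvec (X w) = mu + A *m (\col_j Z j w)].

Definition sample_mean (R : realType) n p (x : 'I_n -> 'cV[R]_p) : 'cV[R]_p :=
  n%:R^-1 *: \sum_i x i.

Definition sample_cov (R : realType) n p (x : 'I_n -> 'cV[R]_p) : 'M[R]_p :=
  n%:R^-1 *: \sum_i (x i - sample_mean x) *m (x i - sample_mean x)^T.

(* The dimensions p >= 1 for which the sample size p / q is an integer. *)
Definition admissible (R : realType) (q : R) : set nat :=
  [set p | (0 < p)%N /\ p%:R / q \is a Num.nat].

(* Equal to p / q when p is admissible. *)
Definition sample_size (R : realType) (q : R) (p : nat) : nat :=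
  Num.truncn (p%:R / q).

(* Indices start at 0: [(lam m)`_i] is the (i+1)-st largest eigenvalue in
   dimension m, and [(lam m)`_m.-1] is the smallest one. *)
Definition near_smallest (R : realType) (lam : nat -> seq R) (kappa : R) (p : nat) :
    {set 'I_p} :=
  [set i : 'I_p | `[< forall m : nat, (p <= m)%N ->
     `| (lam m)`_m.-1 / (lam m)`_i - 1 | < kappa / Num.sqrt m%:R >]].

Definition xi (R : realType) (lam : nat -> seq R) (kappa : R) (p : nat) : nat :=
  #|near_smallest lam kappa p|.

(* Main.v *)
Require Import Defs.
From mathcomp Require Import ring lra measurable_realfun.

Set Implicit Arguments.
Unset Strict Implicit.
Unset Printing Implicit Defensive.

(** Let [v_k] be an orthonormal eigenbasis of [Sigma] and [Q_k] the sum over the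
    sample of [(v_k . Z_i) ^ 2], with [Z_i] the standard normal vector of the
    [i]-th observation. Rayleigh's principle for the vector [v_k], and dropping
    the sample mean, give [l_p <= lambda_k * Q_k / n], so [l_p <= lambda_p] as
    soon as [Q_k <= n - K * sqrt n] for one [k] in [H_{p,kappa}], where
    [K = kappa / sqrt q].

    The joint Laplace transform of the [Q_k] is that of independent chi-square
    variables. To see this without rotating Gaussian measures, write
    [- sum t_k y_k ^ 2 = - s |Z| ^ 2 + sum (s - t_k) y_k ^ 2] with [y_k = v_k . Z]
    and [s >= t_k], and linearize each square by
    [exp (r y ^ 2) = E exp (sqrt (2 r) g y)] with [g] standard normal: only
    nonnegative integrands occur, and after exchanging the integrals the
    coordinates of [Z] separate.

    With [u_k = exp (- (Q_k - n) / sqrt n)], [b = exp (K t)] and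
    [G u = (1 - eps (u ^ t - b)) ^ 2], the event that [Q_k > n - K * sqrt n] for
    all [k] in [H] has probability at most [E (prod_{k in H} G u_k)], which is
    [(E G) ^ |H|]. For [t] large and [eps] small, [E G] is at most a constant
    [rho < 1] for all large [n], because [E u ^ t] exceeds [exp (2 / 9 * t ^ 2)]
    and [E u ^ (2 t)] stays bounded. Hence [P (l_p <= lambda_p) >= 1 - rho ^ xi]. *)

(** * Real symmetric matrices *)

Lemma mx11_sum_sqr (R : comPzRingType) n (v : 'rV[R]_n) :
  (v *m v^T) 0 0 = \sum_i v 0 i ^+ 2.
Proof. by rewrite mxE; apply: eq_bigr => i _; rewrite mxE expr2. Qed.

Lemma rV_norm_gt0 (R : realDomainType) n (v : 'rV[R]_n) :
  v != 0 -> 0 < (v *m v^T) 0 0.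
Proof.
move=> v0; rewrite mx11_sum_sqr lt_def sumr_ge0 ?andbT => [|i _]; last exact: sqr_ge0.
apply: contra v0; rewrite psumr_eq0 => [/allP h|i _]; last exact: sqr_ge0.
apply/eqP/rowP => i; rewrite mxE; apply/eqP.
by rewrite -sqrf_eq0; have := h i (mem_index_enum _).
Qed.

(* [H] is the Householder reflection along [u - v]. *)
Lemma unit_rV_reflection (R : realFieldType) n (u v : 'rV[R]_n) :
  u *m u^T = 1%:M -> v *m v^T = 1%:M ->
  exists H : 'M[R]_n, [/\ H^T = H, H *m H = 1%:M & u *m H = v].
Proof.
move=> uu vv; have [->|uv] := eqVneq u v.
  by exists 1%:M; rewrite trmx1 !mulmx1.
pose w := u - v.
have w0 : 0 < (w *m w^T) 0 0 by apply: rV_norm_gt0; rewrite subr_eq0.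
pose c := 2 / (w *m w^T) 0 0.
have cw : c *: (w *m w^T) = 2%:M.
  by rewrite [w *m w^T]mx11_scalar scale_scalar_mx /c divfK// gt_eqF.
have vu : v *m u^T = u *m v^T.
  rewrite [LHS]mx11_scalar [RHS]mx11_scalar !mxE; congr _%:M.
  by apply: eq_bigr => i _; rewrite !mxE mulrC.
have uw : c *: (u *m w^T) = 1%:M.
  have -> : u *m w^T = 2^-1 *: (w *m w^T).
    have -> : w *m w^T = 2 *: (u *m w^T).
      rewrite /w linearB /= mulmxBl !mulmxBr uu vv vu scaler_nat mulr2n.
      by congr (_ + _); rewrite opprB.
    by rewrite scalerA mulVf ?scale1r// pnatr_eq0.
  by rewrite scalerA mulrC -scalerA cw scale_scalar_mx mulVf// pnatr_eq0.
exists (1%:M - c *: (w^T *m w)); split.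
- by rewrite linearB /= linearZ /= trmx_mul trmxK trmx1.
- have PP : (c *: (w^T *m w)) *m (c *: (w^T *m w)) = 2 *: (c *: (w^T *m w)).
    have cw' := mx11_scalar (w *m w^T).
    rewrite -scalemxAl -scalemxAr mulmxA -[_ *m w *m _]mulmxA cw' mul_mx_scalar.
    rewrite -scalemxAl !scalerA; congr (_ *: _).
    have cx : c * (w *m w^T) 0 0 = 2 by rewrite /c divfK// gt_eqF.
    by rewrite mulrA mulrAC mulrCA cx mulrC.
  move: PP; set P := c *: (w^T *m w) => PP.
  rewrite mulmxBl !mulmxBr !mul1mx mulmx1 PP scaler_nat mulr2n.
  by rewrite opprB addrK subrK.
- rewrite mulmxBr mulmx1 -scalemxAr mulmxA scalemxAl uw mul1mx /w.
  by rewrite opprB addrC subrK.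
Qed.

Lemma char_poly_orthogonal (R : comNzRingType) n (A H : 'M[R]_n) :
  H *m H^T = 1%:M -> char_poly (H *m A *m H^T) = char_poly A.
Proof.
move=> HH; rewrite /char_poly /char_poly_mx.
pose H' := map_mx polyC H; have H'H : H' *m H'^T = 1%:M.
  by rewrite /H' map_trmx -map_mxM HH map_mx1.
have -> : 'X%:M - map_mx polyC (H *m A *m H^T) =
    H' *m ('X%:M - map_mx polyC A) *m H'^T.
  rewrite mulmxBr mulmxBl mul_mx_scalar -scalemxAl H'H scalemx1; congr (_ - _).
  by rewrite !map_mxM /H' map_trmx.
by rewrite !det_mulmx mulrAC -det_mulmx H'H det1 mul1r.
Qed.

Lemma symmetric_diagonalizable (R : rcfType) n (A : 'M[R]_n) (s : seq R) :
  A^T = A -> char_poly A = \prod_(a <- s) ('X - a%:P) ->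
  exists2 V : 'M[R]_n, V *m V^T = 1%:M & A *m V = V *m diag_mx (\row_i s`_i).
Proof.
elim: n A s => [|n IH] A s symA cA.
  by exists 1%:M; rewrite ?flatmx0//; apply/matrixP => -[].
have : size s = n.+1 by have := size_char_poly A; rewrite cA size_prod_XsubC => -[].
case: s cA => // a s cA _.
have /eigenvalueP[v vA v0] : eigenvalue A a.
  by rewrite eigenvalue_root_char cA root_prod_XsubC inE eqxx.
wlog vv : v vA v0 / v *m v^T = 1%:M.
  move=> W; have vgt := rV_norm_gt0 v0; pose r := Num.sqrt ((v *m v^T) 0 0).
  have r0 : r != 0 by rewrite gt_eqF// sqrtr_gt0.
  apply: (W (r^-1 *: v)).
  - by rewrite -scalemxAl vA scalerA mulrC -scalerA.
  - by rewrite scaler_eq0 invr_eq0 (negPf r0).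
  - rewrite linearZ /= -scalemxAl -scalemxAr scalerA [v *m _]mx11_scalar.
    rewrite scale_scalar_mx -(sqr_sqrtr (ltW vgt)) -/r expr2 mulrA.
    by rewrite mulfVK ?mulVf// ?mulf_neq0.
pose e : 'rV[R]_n.+1 := delta_mx 0 0.
have ee : e *m e^T = 1%:M by rewrite /e trmx_delta mul_delta_mx;
  apply/matrixP => i j; rewrite !mxE !ord1.
have [H [symH HH eH]] := unit_rV_reflection ee vv.
have [B BH] : exists B : 'M[R]_(1 + n), B = H *m A *m H by eexists.
have symB : B^T = B by rewrite BH !trmx_mul symH symA mulmxA.
have eB : e *m B = a *: e.
  by rewrite BH !mulmxA eH vA -scalemxAl -eH -mulmxA HH mulmx1.
pose A' := drsubmx B.
have B00 : ulsubmx B = a%:M.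
  rewrite [LHS]mx11_scalar !mxE; congr _%:M.
  have := congr1 (fun M : 'rV_ _ => M 0 0) eB.
  by rewrite /e -rowE !mxE eqxx mulr1 => <-; congr (B _ _); apply: val_inj.
have B01 : ursubmx B = 0.
  apply/matrixP => i j; rewrite !mxE.
  have := congr1 (fun M : 'rV_ _ => M 0 (rshift 1 j)) eB.
  rewrite /e -rowE !mxE /= mulr0 => <-; congr (B _ _); apply: val_inj => /=.
  by rewrite ord1.
have B10 : dlsubmx B = 0.
  by rewrite -(trmxK (dlsubmx B)) trmx_dlsub symB B01 trmx0.
have BE : B = block_mx a%:M 0 0 A' by rewrite -[LHS]submxK B00 B01 B10.
have symA' : A'^T = A' by rewrite /A' trmx_drsub symB.
have cA' : char_poly A' = \prod_(b <- s) ('X - b%:P).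
  have : char_poly B = char_poly A by rewrite BH -{2}symH char_poly_orthogonal// symH.
  rewrite cA big_cons BE /char_poly char_block_diag_mx det_ublock.
  have -> : \det (char_poly_mx (a%:M : 'M[R]_1)) = 'X - a%:P.
    by rewrite /char_poly_mx det_mx11 !mxE eqxx !mulr1n.
  by move/mulfI; apply; rewrite polyXsubC_eq0.
have [V' VV AO] := IH _ _ symA' cA'.
pose V2 : 'M[R]_(1 + n) := block_mx 1%:M 0 0 V'.
have V2V : V2 *m V2^T = 1%:M.
  rewrite /V2 tr_block_mx mulmx_block !(trmx0, mulmx0, mul0mx, addr0, add0r).
  by rewrite trmx1 mulmx1 VV -scalar_mx_block.
exists (H *m V2).
  by rewrite trmx_mul symH mulmxA -[H *m _ *m _]mulmxA V2V mulmx1.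
have -> : A *m (H *m V2) = H *m (B *m V2).
  by rewrite BH !mulmxA HH mul1mx.
rewrite -mulmxA; congr (H *m _).
have -> : diag_mx (\row_i (a :: s)`_i) = block_mx a%:M 0 0 (diag_mx (\row_i s`_i)) :> 'M[R]_(1 + n).
  rewrite -[\row_i (a :: s)`_i](@hsubmxK _ 1 1 n) diag_mx_row; congr block_mx.
    by apply/matrixP => i j; rewrite !mxE !ord1.
  by congr diag_mx; apply/rowP => i; rewrite !mxE.
rewrite BE /V2 mulmx_block (@mulmx_block _ 1 n 1 n 1 n).
rewrite !(mulmx0, mul0mx, addr0, add0r).
by rewrite mulmx1 mul1mx AO.
Qed.

Lemma min_eigenvalue_le (R : rcfType) n (A : 'M[R]_n.+1) (s : seq R) (v : 'rV[R]_n.+1) :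
  A^T = A -> sorted >=%R s -> char_poly A = \prod_(a <- s) ('X - a%:P) ->
  v *m v^T = 1%:M -> s`_n <= (v *m A *m v^T) 0 0.
Proof.
move=> symA ss cA vv; have [V VV AO] := symmetric_diagonalizable symA cA.
have sz : size s = n.+1 by have := size_char_poly A; rewrite cA size_prod_XsubC => -[].
have OtO : V^T *m V = 1%:M by exact: mulmx1C.
pose y := v *m V; have -> : v *m A *m v^T = y *m diag_mx (\row_i s`_i) *m y^T.
  rewrite /y trmx_mul -!mulmxA; congr (v *m _); rewrite !mulmxA -AO.
  by rewrite -[A *m V *m _]mulmxA VV mulmx1.
have yy : \sum_i y 0 i ^+ 2 = 1.
  by rewrite -mx11_sum_sqr /y trmx_mul mulmxA -[v *m V *m _]mulmxA VV mulmx1 vv mxE.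
rewrite -[leLHS]mulr1 -yy mulr_sumr mxE; apply: ler_sum => i _.
rewrite mul_mx_diag !mxE mulrAC -expr2 mulrC ler_wpM2l ?sqr_ge0//.
have [->//|ni] := eqVneq (i : nat) n.
have ilt : (i < n)%N by rewrite ltn_neqAle ni -ltnS ltn_ord.
have ge_trans : transitive (>=%R : rel R) by move=> x y' z h1 h2; exact: le_trans h2 h1.
have := sorted_ltn_nth ge_trans 0 ss i n.
by rewrite !inE sz ltn_ord ltnSn => /(_ isT isT ilt).
Qed.

Lemma posdef_sqrt_eigenvector (R : rcfType) n (A : 'M[R]_n) (a : R) (v : 'cV[R]_n) :
  A^T = A -> (forall w : 'cV[R]_n, w != 0 -> 0 < (w^T *m A *m w) 0 0) ->
  0 <= a -> A *m A *m v = a *: v -> A *m v = Num.sqrt a *: v.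
Proof.
move=> symA pA a0 AAv; pose w := A *m v - Num.sqrt a *: v.
suff : w = 0 by move/eqP; rewrite subr_eq0 => /eqP.
have Aw : A *m w = - (Num.sqrt a *: w).
  rewrite /w mulmxBr mulmxA AAv -scalemxAr scalerBr scalerA -expr2 sqr_sqrtr//.
  by rewrite opprB.
have [//|/pA] := eqVneq w 0.
have -> : w^T *m A *m w = - (Num.sqrt a *: (w^T *m w)).
  by rewrite -mulmxA Aw mulmxN -scalemxAr.
have ww : 0 <= (w^T *m w) 0 0.
  by rewrite mxE sumr_ge0// => i _; rewrite mxE -expr2 sqr_ge0.
by rewrite mxE mxE oppr_gt0 ltNge mulr_ge0// sqrtr_ge0.
Qed.

(** * Measurability of the smallest eigenvalue *)

Lemma sum_sqr_mean_le (R : realFieldType) n (a : 'I_n -> R) (m : R) :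
  \sum_i (a i - n%:R^-1 * \sum_j a j) ^+ 2 <= \sum_i (a i - m) ^+ 2.
Proof.
case: n a => [|n] a; first by rewrite !big_ord0.
set s := n.+1%:R^-1 * \sum_j a j.
have as0 : \sum_i (a i - s) = 0.
  rewrite sumrB sumr_const card_ord -[s *+ _]mulr_natl /s mulrA divff ?mul1r ?subrr//.
have -> : \sum_i (a i - m) ^+ 2 =
    \sum_i (a i - s) ^+ 2 + (s - m) ^+ 2 *+ n.+1.
  have -> : (s - m) ^+ 2 *+ n.+1 = \sum_(i < n.+1) (s - m) ^+ 2.
    by rewrite sumr_const card_ord.
  rewrite -big_split /=.
  apply/eqP; rewrite -subr_eq0 -sumrB.
  rewrite (eq_bigr (fun i => (s - m) *+ 2 * (a i - s))); last by move=> i _; ring.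
  by rewrite -mulr_sumr as0 mulr0.
by rewrite lerDl mulrn_wge0// sqr_ge0.
Qed.

Lemma sample_cov_sym (R : realType) n p (x : 'I_n -> 'cV[R]_p) :
  (sample_cov x)^T = sample_cov x.
Proof.
rewrite /sample_cov linearZ /= linear_sum /=; congr (_ *: _).
by apply: eq_bigr => i _; rewrite trmx_mul trmxK.
Qed.

Lemma sample_cov_form_le (R : realType) n p (x : 'I_n -> 'cV[R]_p)
    (v : 'rV[R]_p) (mu : 'cV[R]_p) :
  (v *m sample_cov x *m v^T) 0 0 <=
  n%:R^-1 * \sum_i ((v *m (x i - mu)) 0 0) ^+ 2.
Proof.
have -> : (v *m sample_cov x *m v^T) 0 0 = n%:R^-1 *
    \sum_i ((v *m x i) 0 0 - n%:R^-1 * \sum_j (v *m x j) 0 0) ^+ 2.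
  rewrite /sample_cov -scalemxAr -scalemxAl mxE; congr (_ * _).
  rewrite mulmx_sumr mulmx_suml summxE; apply: eq_bigr => i _.
  rewrite mulmxA -[_ *m _ *m v^T]mulmxA -trmx_mul.
  have -> : v *m (x i - sample_mean x) = ((v *m x i) 0 0 - n%:R^-1 * \sum_j (v *m x j) 0 0)%:M.
    rewrite [LHS]mx11_scalar mulmxBr /sample_mean -scalemxAr mulmx_sumr.
    by congr _%:M; rewrite !mxE summxE.
  by rewrite tr_scalar_mx -scalar_mxM mxE expr2.
rewrite ler_wpM2l ?invr_ge0//.
apply: le_trans (sum_sqr_mean_le _ ((v *m mu) 0 0)) _.
by apply: ler_sum => i _; rewrite mulmxBr !mxE.
Qed.

Lemma size_prod_XaddC (R : nzRingType) (I : Type) (s : seq I) (f : I -> R) :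
  size (\prod_(i <- s) ('X + (f i)%:P)) = (size s).+1.
Proof.
rewrite -(size_prod_XsubC s (fun i => - f i)); congr (size (polyseq _)).
by apply: eq_bigr => i _; rewrite polyCN opprK.
Qed.

Lemma prod_XaddC_coef_gt0 (R : realDomainType) (s : seq R) :
  all (> 0) s -> forall j, (j <= size s)%N -> 0 < (\prod_(a <- s) ('X + a%:P))`_j.
Proof.
elim: s => [_ j|a s IH /= /andP[a0 /IH{}IH] j]; first by rewrite leqn0 big_nil coef1 => /eqP ->.
rewrite big_cons mulrDl coefD coefXM coefCM => js.
have ge0 k : 0 <= (\prod_(b <- s) ('X + b%:P))`_k.
  by have [/IH/ltW//|ks] := leqP k (size s); rewrite nth_default ?(size_prod_XaddC s id).
case: j js => [|j] js /=; first by rewrite add0r mulr_gt0// IH.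
by rewrite ltr_pwDl ?IH// mulr_ge0// ltW.
Qed.

(* The left-hand side involves finitely many polynomials in the coefficients of [p],
   so it is a measurable condition when those are random. *)
Lemma all_gt_coefP (R : realDomainType) (s : seq R) (c : R) :
  let p := \prod_(a <- s) ('X - a%:P) in
  (forall j, (j <= size s)%N -> 0 < (-1) ^+ size s * (p \Po (c%:P - 'X))`_j) <->
  all (> c) s.
Proof.
move=> /=; set p := \prod_(a <- s) _.
have pE : (-1) ^+ size s *: (p \Po (c%:P - 'X)) = \prod_(a <- map (+%R^~ (- c)) s) ('X + a%:P).
  rewrite /p; elim: s {p} => [|a s IH] /=; first by rewrite !big_nil scale1r comp_polyC.
  rewrite !big_cons comp_polyM exprS -scalerA scalerAr -IH scaleN1r -mulNr.
  by congr (_ * _); rewrite comp_polyB comp_polyX comp_polyC opprB polyCB; ring.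
have coefE j : (-1) ^+ size s * (p \Po (c%:P - 'X))`_j =
    (\prod_(a <- map (+%R^~ (- c)) s) ('X + a%:P))`_j by rewrite -pE coefZ.
split=> [h|h j js]; last first.
  rewrite coefE prod_XaddC_coef_gt0 ?size_map// all_map.
  by apply: sub_all h => a /=; rewrite subr_gt0.
apply/allP => a sa /=; rewrite ltNge; apply/negP => ac.
set r := \prod_(a <- map _ s) _ in coefE.
have : 0 < r.[c - a].
  rewrite horner_coef.
  have szr : size r = (size s).+1 by rewrite /r big_map size_prod_XaddC.
  rewrite szr big_ord_recl /= expr0 mulr1 ltr_wpDr//.
    rewrite sumr_ge0// => i _; rewrite mulr_ge0 ?exprn_ge0 ?subr_ge0//.
    by rewrite -coefE ltW// h// ltn_ord.
  by rewrite -coefE h.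
rewrite /r horner_prod big_map (big_rem a)//= hornerD hornerX hornerC.
by rewrite addrA subrK subrr mul0r ltxx.
Qed.

Definition measurable_coefs d (T : measurableType d) (R : realType)
  (f : T -> {poly R}) := forall j, measurable_fun setT (fun w => (f w)`_j).

Section measurable_coefs.
Context d (T : measurableType d) (R : realType).
Implicit Types f g : T -> {poly R}.

Lemma measurable_coefs_cst q : measurable_coefs (fun _ : T => q : {poly R}).
Proof. by move=> j. Qed.

Lemma measurable_coefsC (h : T -> R) :
  measurable_fun setT h -> measurable_coefs (fun w => (h w)%:P).
Proof.
move=> mh j; under eq_fun do rewrite coefC.
case: (j == 0%N); [exact: mh|exact: measurable_cst].
Qed.

Lemma measurable_coefsD f g : measurable_coefs f -> measurable_coefs g ->
  measurable_coefs (fun w => f w + g w).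
Proof.
by move=> mf mg j; under eq_fun do rewrite coefD; exact: measurable_funD.
Qed.

Lemma measurable_coefsM f g : measurable_coefs f -> measurable_coefs g ->
  measurable_coefs (fun w => f w * g w).
Proof.
move=> mf mg j; under eq_fun do rewrite coefM.
by apply: measurable_sum => i; exact: measurable_funM.
Qed.

Lemma measurable_coefs_sum (I : Type) (s : seq I) (f : I -> T -> {poly R}) :
  (forall i, measurable_coefs (f i)) ->
  measurable_coefs (fun w => \sum_(i <- s) f i w).
Proof.
move=> mf j; under eq_fun do rewrite coef_sum.
by apply: measurable_sum => i; exact: mf.
Qed.

Lemma measurable_coefs_prod (I : Type) (s : seq I) (f : I -> T -> {poly R}) :
  (forall i, measurable_coefs (f i)) ->
  measurable_coefs (fun w => \prod_(i <- s) f i w).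
Proof.
move=> mf; elim: s => [|i s IH].
  by under eq_fun do rewrite big_nil; exact: measurable_coefs_cst.
by under eq_fun do rewrite big_cons; exact: measurable_coefsM.
Qed.

Lemma measurable_coefs_char_poly n (M : T -> 'M[R]_n) :
  (forall i j, measurable_fun setT (fun w => M w i j)) ->
  measurable_coefs (fun w => char_poly (M w)).
Proof.
move=> mM; rewrite /char_poly /determinant.
apply: measurable_coefs_sum => s; apply: measurable_coefsM.
  exact: measurable_coefs_cst.
apply: measurable_coefs_prod => i; under eq_fun do rewrite !mxE -polyCN.
apply: measurable_coefsD; first exact: measurable_coefs_cst.
by apply: measurable_coefsC; exact: measurableT_comp.
Qed.

Lemma measurable_coefs_comp n f (q : {poly R}) : (forall w, size (f w) = n) ->
  measurable_coefs f -> measurable_coefs (fun w => f w \Po q).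
Proof.
move=> sf mf j; under eq_fun do rewrite coef_comp_poly sf.
by apply: measurable_sum => i; exact: measurable_funM.
Qed.

End measurable_coefs.

Lemma measurable_min_eigenvalue_le d (T : measurableType d) (R : realType) n
    (M : T -> 'M[R]_n.+1) (s : T -> seq R) (c : R) :
  (forall i j, measurable_fun setT (fun w => M w i j)) ->
  (forall w, is_spectrum (M w) (s w)) ->
  measurable [set w | (s w)`_n <= c].
Proof.
move=> mM sM.
have szs w : size (s w) = n.+1.
  by have [_] := sM w; have := size_char_poly (M w) => + cM; rewrite cM size_prod_XsubC => -[].
pose coef j w : R := (-1) ^+ n.+1 * (char_poly (M w) \Po (c%:P - 'X))`_j.
have mcoef j : measurable_fun setT (coef j).
  apply: measurable_funM => //.
  apply: (@measurable_coefs_comp _ _ _ n.+2); first by move=> w; rewrite size_char_poly.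
  exact: measurable_coefs_char_poly.
have -> : [set w | (s w)`_n <= c] = ~` \bigcap_(j < n.+2) [set w | 0 < coef j w].
  apply/seteqP; split => w.
    move=> /= sc h; move: sc; apply/negP; rewrite -ltNge.
    have [_ cM] := sM w.
    have /allP : all (> c) (s w).
      by apply/all_gt_coefP => j; rewrite -cM szs => jn; exact: h.
    by apply; rewrite mem_nth// szs.
  move=> /= h; rewrite leNgt; apply/negP => sc; apply: h => j /= jn.
  have [ss cM] := sM w; rewrite /coef cM -(szs w).
  apply: (all_gt_coefP (s w) c).2; last by rewrite szs.
  have ge_trans : transitive (>=%R : rel R) by move=> x y z h1 h2; exact: le_trans h2 h1.
  apply/(all_nthP 0) => i; rewrite szs => lin; apply: lt_le_trans sc _.
  have [->//|ni] := eqVneq i n.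
  have := sorted_ltn_nth ge_trans 0 ss i n.
  by rewrite !inE szs lin ltnSn => /(_ isT isT); apply; rewrite ltn_neqAle ni -ltnS.
apply: measurableC; apply: bigcap_measurable => [|j _]; first by exists 0%N.
rewrite -[X in measurable X]setTI.
have -> : [set w | 0 < coef j w] = (fun w => 0 < coef j w) @^-1` [set true].
  by apply/seteqP; split => w /=.
by apply: measurable_realfun.measurable_fun_ltr => //.
Qed.

(** * Integrals of products of independent variables *)

Section integral_comp.
Import HBNNSimple.


Lemma ge0_integral_mul_comp d (T : measurableType d) d' (U : measurableType d')
    (R : realType) (mu : {measure set T -> \bar R}) (nu : {measure set U -> \bar R})
    (h : T -> R) (Y : T -> U) (f : U -> R) (c : R) :
  measurable_fun setT h -> (forall w, 0 <= h w) -> measurable_fun setT Y ->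
  measurable_fun setT f -> (forall x, 0 <= f x) -> 0 <= c ->
  (forall B, measurable B ->
     \int[mu]_w (h w * \1_B (Y w))%:E = c%:E * nu B)%E ->
  (\int[mu]_w (h w * f (Y w))%:E = c%:E * \int[nu]_x (f x)%:E)%E.
Proof.
move=> mh h0 mY mf f0 c0 hB.
have mEf : measurable_fun setT (EFin \o f) by exact/measurable_EFinP.
pose g := nnsfun_approx measurableT mEf.
have mgY n : measurable_fun setT (fun w => g n (Y w)).
  by apply: (measurableT_comp (measurable_funPT (g n))).
have gf x : (g n x)%:E @[n --> \oo] --> (f x)%:E.
  by apply: (cvg_nnsfun_approx measurableT mEf) => // y _ /=; rewrite lee_fin.
have ndg x : {homo (fun n => g n x) : n m / (n <= m)%N >-> n <= m}.
  by move=> n m nm; exact/lefP/nd_nnsfun_approx.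
have cvg1 : (\int[mu]_w (h w * g n (Y w))%:E @[n --> \oo] -->
    \int[mu]_w (h w * f (Y w))%:E)%E.
  have -> : (\int[mu]_w (h w * f (Y w))%:E =
      \int[mu]_w (limn (fun n => (h w * g n (Y w))%:E)))%E.
    apply: eq_integral => w _; apply/esym/cvg_lim => //.
    under eq_fun do rewrite EFinM.
    by rewrite EFinM; apply: cvgeZl => //; exact: gf.
  apply: cvg_monotone_convergence => //.
  - by move=> n; apply/measurable_EFinP; exact: measurable_funM.
  - by move=> n w _; rewrite lee_fin mulr_ge0.
  - by move=> w _ n m nm; rewrite lee_fin ler_wpM2l// ndg.
have cvg2 : (\int[nu]_x (g n x)%:E @[n --> \oo] --> \int[nu]_x (f x)%:E)%E.
  have -> : (\int[nu]_x (f x)%:E = \int[nu]_x (limn (fun n => (g n x)%:E)))%E.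
    by apply: eq_integral => x _; apply/esym/cvg_lim => //; exact: gf.
  apply: cvg_monotone_convergence => //.
  - by move=> n; apply/measurable_EFinP; exact: measurable_funPT.
  - by move=> n x _; rewrite lee_fin.
  - by move=> x _ n m nm; rewrite lee_fin ndg.
have eqn n : (\int[mu]_w (h w * g n (Y w))%:E = c%:E * \int[nu]_x (g n x)%:E)%E.
  have mpre y : measurable (g n @^-1` [set y]) by [].
  have mi y : measurable_fun setT (fun w => \1_(g n @^-1` [set y]) (Y w) : R).
    by apply: measurableT_comp => //; exact: measurable_indic.
  transitivity (\int[mu]_w (\sum_(y \in range (g n))
      (h w * (y * \1_(g n @^-1` [set y]) (Y w)))%:E)%R)%E.
    apply: eq_integral => w _; rewrite fsumEFin//; congr EFin.
    by rewrite {1}(fimfunE (g n) (Y w)) !fsbig_finite//= mulr_sumr.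
  rewrite ge0_integral_fsum//; last 2 first.
  - move=> y; apply/measurable_EFinP; apply: measurable_funM => //.
    exact: measurable_funM.
  - move=> y w _; rewrite lee_fin mulr_ge0//.
    by have := nnfun_muleindic_ge0 (g n) y (Y w); rewrite lee_fin.
  transitivity (c%:E * \int[nu]_x (\sum_(y \in range (g n))
      (y * \1_(g n @^-1` [set y]) x)%:E)%R)%E; last first.
    congr (_ * _)%E; apply: eq_integral => x _; rewrite fsumEFin//.
    by congr EFin; rewrite (fimfunE (g n) x).
  rewrite ge0_integral_fsum//; last 2 first.
  - by move=> y; apply/measurable_EFinP; exact: measurable_funM.
  - by move=> y x _; exact: nnfun_muleindic_ge0.
  rewrite ge0_mule_fsumr; last first.
    by move=> y; apply: integral_ge0 => x _; exact: nnfun_muleindic_ge0.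
  apply: eq_fsbigr => y /set_mem[x _ <-].
  have y0 : 0 <= g n x by [].
  under eq_integral do rewrite mulrCA EFinM.
  rewrite ge0_integralZl//; last 2 first.
  - by apply/measurable_EFinP; exact: measurable_funM.
  - by move=> w _; rewrite lee_fin mulr_ge0.
  rewrite hB//.
  under [in RHS]eq_integral do rewrite EFinM.
  rewrite ge0_integralZl//; last by apply/measurable_EFinP; exact: measurable_indic.
  by rewrite muleCA integral_indic ?setIT.
apply: (cvg_unique _ cvg1) => //.
rewrite (_ : (fun n => _) = fun n => (c%:E * \int[nu]_x (g n x)%:E)%E); last exact/funext.
exact: cvgeZl.
Qed.

End integral_comp.

Section independence.
Context d (T : measurableType d) (R : realType) (P : probability T R).
Context d' (U : measurableType d').

Lemma mutually_independent_prod (I : finType) (X : I -> {RV P >-> U})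
    (f : I -> U -> R) (e : I -> R) :
  mutually_independent X ->
  (forall i, measurable_fun setT (f i)) -> (forall i x, 0 <= f i x) ->
  (forall i, \int[P]_w (f i (X i w))%:E = (e i)%:E)%E ->
  (\int[P]_w (\prod_i f i (X i w))%:E = (\prod_i e i)%:E)%E.
Proof.
move=> indX; have mX i : measurable_fun setT (X i) by exact: measurable_funPT.
have [n] := ubnP #|[set: I]%SET|.
have : forall i, i \notin [set: I]%SET -> exists2 B, measurable B & f i = \1_B.
  by move=> i; rewrite inE.
move: [set: I]%SET => A; elim: n A f e => // n IH A f e fA cA mf f0 ef.
have [A0|[k kA]] := set_0Vmem A.
  have {}fA i : {B | measurable B & f i = \1_B}.
    by apply: cid2; apply: fA; rewrite A0 inE.
  pose B i := s2val (fA i).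
  have mB i : measurable (B i) by rewrite /B; case: (fA i).
  have fB i : f i = \1_(B i) by rewrite /B; case: (fA i).
  have mXB i : measurable (X i @^-1` B i).
    by rewrite -[X in measurable X]setTI; exact: mX.
  transitivity (\int[P]_w (\1_(\bigcap_i (X i @^-1` B i)) w)%:E)%E.
    apply: eq_integral => w _; congr EFin.
    rewrite [RHS]indicE; case: (boolP (w \in _)) => [/set_mem wB|].
      by rewrite big1// => i _; rewrite fB indicE mem_set//; exact: wB.
    move=> /negP wB; have [i iB] : exists i, ~ B i (X i w).
      apply: contrapT => h; apply: wB; apply/mem_set => i _ /=.
      by apply: contrapT => ?; apply: h; exists i.
    by rewrite (bigD1 i)//= fB indicE memNset// mul0r.
  rewrite integral_indic ?setIT//; last first.
    by apply: fin_bigcap_measurable => //; exact: finite_finset.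
  etransitivity; first exact: (indX B mB).
  rewrite -prodEFin; apply: eq_bigr => i _.
  rewrite -ef fB -[RHS]/(\int[P]_w (\1_(X i @^-1` B i) w)%:E)%E.
  by rewrite integral_indic ?setIT.
have ge0e i : 0 <= e i by rewrite -lee_fin -ef integral_ge0// => w _; rewrite lee_fin.
pose h w := \prod_(i | i != k) f i (X i w).
have -> : (\int[P]_w (\prod_i f i (X i w))%:E = \int[P]_w (h w * f k (X k w))%:E)%E.
  by apply: eq_integral => w _; rewrite (bigD1 k)//= mulrC.
rewrite (@ge0_integral_mul_comp _ _ _ _ _ _ (distribution P (X k)) h (X k) (f k)
  (\prod_(i | i != k) e i)) => //.
- rewrite (@ge0_integral_distribution _ _ _ _ _ _ _ (EFin \o f k)).
  + by rewrite ef -EFinM [in RHS](bigD1 k)//= mulrC.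
  + exact/measurable_EFinP.
  + by move=> x; rewrite lee_fin.
- rewrite /h; under eq_fun do rewrite big_mkcond.
  apply: measurable_prod => i _; case: (i != k); last exact: measurable_cst.
  exact: measurableT_comp.
- by move=> w; apply: prodr_ge0.
- by apply: prodr_ge0.
- move=> B mB.
  pose f' i := if i == k then \1_B else f i : U -> R.
  pose e' i := if i == k then fine (P (X k @^-1` B)) else e i.
  have mXB : measurable (X k @^-1` B).
    by rewrite -[X in measurable X]setTI; exact: mX.
  have ePB : (e' k)%:E = distribution P (X k) B.
    by rewrite /e' eqxx fineK// fin_num_measure.
  transitivity ((\prod_(i | i != k) e i)%:E * (e' k)%:E)%E; last by rewrite ePB.
  rewrite -EFinM.
  have -> : \prod_(i | i != k) e i * e' k = \prod_i e' i.
    rewrite [RHS](bigD1 k)//= mulrC; congr (_ * _).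
    by apply: eq_bigr => i /negPf ik; rewrite /e' ik.
  rewrite -(IH (A :\ k)%SET f')//.
  + apply: eq_integral => w _; congr EFin; rewrite [RHS](bigD1 k)//= mulrC.
    rewrite {1}/f' eqxx; congr (_ * _); apply: eq_bigr => i /negPf ik.
    by rewrite /f' ik.
  + move=> i; rewrite !inE negb_and negbK /f'.
    by have [_ _|_ /fA//] := eqVneq i k; exists B.
  + by move: cA; rewrite (cardsD1 k) kA ltnS.
  + by move=> i; rewrite /f'; case: eqP => // _; exact: measurable_indic.
  + by move=> i x; rewrite /f'; case: eqP.
  + move=> i; rewrite /f'; have [->|ik] := eqVneq i k; last by rewrite /e' (negPf ik).
    rewrite ePB -[LHS]/(\int[P]_w (\1_(X k @^-1` B) w)%:E)%E.
    by rewrite integral_indic ?setIT.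
Qed.
End independence.

(** * Gaussian quadratic forms *)

Lemma integral_normal_prob (R : realType) (m s : R) (f : R -> R) :
  measurable_fun setT f -> (forall x, 0 <= f x) ->
  (\int[normal_prob m s]_x (f x)%:E =
   \int[lebesgue_measure]_x (normal_pdf m s x * f x)%:E)%E.
Proof.
move=> mf f0.
rewrite (@ge0_integral_mul_comp _ _ _ _ _ lebesgue_measure (normal_prob m s) _ idfun f 1)//.
- by rewrite mul1e.
- exact: measurable_normal_pdf.
- by move=> x; exact: normal_pdf_ge0.
- exact: measurable_id.
- move=> B mB; rewrite mul1e /normal_prob [RHS]integral_mkcond.
  by apply: eq_integral => x _; rewrite epatch_indic EFinM.
Qed.

(* [sigma = 1 + 2 s] is the inverse variance of the standard normal law tilted by
   [expR (- s * z ^+ 2)]. *)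
Definition gauss_mgf (R : realType) (sigma a : R) : R :=
  (Num.sqrt sigma)^-1 * expR (a ^+ 2 / (2 * sigma)).

Lemma integral_normal_exp_quadratic (R : realType) (s a : R) : 0 < 1 + 2 * s ->
  (\int[normal_prob 0 1]_x (expR (- s * x ^+ 2 + a * x))%:E =
   (gauss_mgf (1 + 2 * s) a)%:E)%E.
Proof.
set sigma := 1 + 2 * s => s0.
have sq0 : 0 < Num.sqrt sigma by rewrite sqrtr_gt0.
pose tau := (Num.sqrt sigma)^-1.
have tau0 : tau != 0 by rewrite gt_eqF// invr_gt0.
have tau2 : tau ^+ 2 = sigma^-1 by rewrite exprVn sqr_sqrtr// ltW.
rewrite integral_normal_prob; last by move=> x; exact: expR_ge0.
  transitivity (\int[lebesgue_measure]_x ((gauss_mgf sigma a)%:E *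
      (normal_pdf (a / sigma) tau x)%:E))%E.
    apply: eq_integral => x _; rewrite -EFinM; congr EFin.
    rewrite !normal_pdfE ?oner_eq0// /normal_peak /normal_fun /gauss_mgf.
    have -> : (Num.sqrt (tau ^+ 2 * pi *+ 2))^-1 =
        Num.sqrt sigma * (Num.sqrt (1 ^+ 2 * pi *+ 2))^-1.
      rewrite -[in RHS](invrK (Num.sqrt sigma)) -invfM -/tau; congr _^-1.
      by rewrite -!mulrnAr sqrtrM ?sqr_ge0// sqrtr_sqr
        ger0_norm ?invr_ge0 ?sqrtr_ge0// expr1n mul1r.
    set S := Num.sqrt sigma in sq0 *; set p1 := _^-1; rewrite -!mulrA -expRD.
    set EB := expR (- (x - a / sigma) ^+ 2 / _).
    rewrite [RHS](_ : _ = (S^-1 * S) * (p1 * (expR (a * (a / (2 * sigma))) * EB))); last by ring.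
    rewrite mulVf ?gt_eqF// mul1r /EB -expRD; congr (_ * expR _).
    rewrite tau2 /sigma; field.
    by rewrite gt_eqF.
  rewrite ge0_integralZl//=.
  - by rewrite integral_normal_pdf mule1.
  - by apply/measurable_EFinP; exact: measurable_normal_pdf.
  - by move=> x _; rewrite lee_fin normal_pdf_ge0.
  - by rewrite lee_fin mulr_ge0 ?expR_ge0// invr_ge0.
apply: measurableT_comp => //; apply: measurable_funD; apply: measurable_funM => //.
Qed.

Lemma expR_sqr_integral (R : realType) (r y : R) : 0 <= r ->
  (\int[normal_prob 0 1]_g (expR (Num.sqrt (2 * r) * y * g))%:E =
   (expR (r * y ^+ 2))%:E)%E.
Proof.
move=> r0.
have := @integral_normal_exp_quadratic R 0 (Num.sqrt (2 * r) * y).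
rewrite mulr0 addr0 ltr01 => /(_ isT).
rewrite /gauss_mgf sqrtr1 invr1 mul1r mulr1 exprMn sqr_sqrtr ?mulr_ge0//.
rewrite (_ : 2 * r * y ^+ 2 / 2 = r * y ^+ 2); last by field.
by move=> <-; apply: eq_integral => g _; rewrite oppr0 mul0r add0r.
Qed.

Lemma measurable_gauss_mgf (R : realType) (sigma : R) :
  measurable_fun setT (gauss_mgf sigma).
Proof.
apply: measurable_funM => //; apply: measurableT_comp => //.
by apply: measurable_funM => //; apply: measurable_funX.
Qed.

Lemma gauss_mgf_ge0 (R : realType) (sigma a : R) : 0 <= gauss_mgf sigma a.
Proof. by rewrite mulr_ge0 ?expR_ge0// invr_ge0 sqrtr_ge0. Qed.

Lemma integral_gauss_mgf (R : realType) (sigma r a : R) : 0 <= r -> 2 * r < sigma ->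
  (\int[normal_prob 0 1]_g (gauss_mgf sigma (a + Num.sqrt (2 * r) * g))%:E =
   (gauss_mgf (sigma - 2 * r) a)%:E)%E.
Proof.
move=> r0 rs; have s0 : 0 < sigma by rewrite (le_lt_trans _ rs)// mulr_ge0.
set c := Num.sqrt (2 * r); have c2 : c ^+ 2 = 2 * r by rewrite sqr_sqrtr// mulr_ge0.
have e1 : 1 + 2 * (- r / sigma) = (sigma - 2 * r) / sigma.
  by field; rewrite gt_eqF.
have := @integral_normal_exp_quadratic R (- r / sigma) (a * c / sigma).
rewrite e1 divr_gt0 ?subr_gt0// => /(_ isT) h.
transitivity (\int[normal_prob 0 1]_g ((gauss_mgf sigma a)%:E *
   (expR (- (- r / sigma) * g ^+ 2 + a * c / sigma * g))%:E))%E.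
  apply: eq_integral => g _; rewrite -EFinM; congr EFin.
  rewrite /gauss_mgf -[RHS]mulrA -expRD.
  congr (_ * expR _); rewrite sqrrD exprMn c2; field.
  by rewrite gt_eqF.
rewrite ge0_integralZl//=; last 2 first.
- apply/measurable_EFinP; apply: measurableT_comp => //.
  by apply: measurable_funD; apply: measurable_funM => //; apply: measurable_funX.
- by rewrite lee_fin gauss_mgf_ge0.
rewrite h -EFinM /gauss_mgf mulrACA -expRD; congr (_ * expR _)%:E.
  by rewrite -invfM -sqrtrM ?(ltW s0)// mulrCA divff ?mulr1// gt_eqF.
rewrite expr_div_n exprMn c2; field.
by rewrite subr_eq0 ?gt_eqF.
Qed.

Section gaussian_vector.
Context d (T : measurableType d) (R : realType) (P : probability T R) (p : nat).
Variables (Z : 'I_p -> {RV P >-> R}) (O : 'M[R]_p).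
Hypothesis indZ : mutually_independent Z.
Hypothesis normZ : forall j B, measurable B ->
  distribution P (Z j) B = normal_prob 0 1 B.
Hypothesis OO : O *m O^T = 1%:M.

Let y k w := \sum_j Z j w * O j k.

Let mZ j : measurable_fun setT (Z j). Proof. exact: measurable_funPT. Qed.

Let my k : measurable_fun setT (y k).
Proof.
by apply: measurable_sum => j; apply: measurable_funM.
Qed.

Lemma integral_normal_comp j (f : R -> R) :
  measurable_fun setT f -> (forall x, 0 <= f x) ->
  (\int[P]_w (f (Z j w))%:E = \int[normal_prob 0 1]_x (f x)%:E)%E.
Proof.
move=> mf f0.
transitivity (\int[P]_w (cst 1 w * f (Z j w))%:E)%E.
  by apply: eq_integral => w _; rewrite mul1r.
rewrite (@ge0_integral_mul_comp _ _ _ _ _ P (normal_prob 0 1) (cst 1) (Z j) f 1)//.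
  by rewrite mul1e.
  exact: mZ.
move=> B mB; rewrite mul1e.
transitivity (distribution P (Z j) B); last exact: normZ.
under eq_integral do rewrite mul1r.
rewrite -[LHS]/(\int[P]_w (\1_(Z j @^-1` B) w)%:E)%E integral_indic ?setIT//.
by rewrite -[X in measurable X]setTI; exact: mZ.
Qed.

Lemma integral_exp_normal_vector (s : R) (a : 'I_p -> R) : 0 <= s ->
  (\int[P]_w (expR (- s * (\sum_j Z j w ^+ 2) + \sum_k a k * y k w))%:E =
   (\prod_k gauss_mgf (1 + 2 * s) (a k))%:E)%E.
Proof.
move=> s0; have sg0 : 0 < 1 + 2 * s by rewrite ltr_pwDl// mulr_ge0.
pose b j := \sum_k O j k * a k.
pose f j (x : R) := expR (- s * x ^+ 2 + b j * x).
transitivity (\int[P]_w (\prod_j f j (Z j w))%:E)%E.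
  apply: eq_integral => w _; rewrite -expR_sum; congr (expR _)%:E.
  rewrite big_split /= -mulr_sumr; congr (_ + _).
  under eq_bigr do rewrite /y mulr_sumr.
  rewrite exchange_big /=; apply: eq_bigr => j _.
  by rewrite /b mulr_suml; apply: eq_bigr => k _; ring.
have mf j : measurable_fun setT (f j).
  apply: measurableT_comp => //.
  by apply: measurable_funD; apply: measurable_funM => //; apply: measurable_funX.
have f0 j x : 0 <= f j x by exact: expR_ge0.
rewrite (mutually_independent_prod (e := fun j => gauss_mgf (1 + 2 * s) (b j)) indZ mf f0).
- rewrite /gauss_mgf !big_split /= -!expR_sum; congr (_ * expR _)%:E.
  rewrite -!mulr_suml; congr (_ / _).
  have OtO : O^T *m O = 1%:M by exact: mulmx1C.
  pose u : 'cV_p := \col_k a k.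
  have bE j : b j = (O *m u) j 0.
    by rewrite mxE; apply: eq_bigr => k _; rewrite mxE.
  transitivity (((O *m u)^T *m (O *m u)) 0 0).
    by rewrite mxE; apply: eq_bigr => j _; rewrite bE expr2; congr (_ * _); rewrite [RHS]mxE.
  rewrite trmx_mul -mulmxA (mulmxA O^T) OtO mul1mx mxE.
  by apply: eq_bigr => k _; rewrite !mxE expr2.
- by move=> j; rewrite (integral_normal_comp _ (mf j))// -integral_normal_exp_quadratic.
Qed.

Lemma integral_exp_quadratic_form (s : R) (r a : 'I_p -> R) : 0 <= s ->
  (forall k, 0 <= r k) -> (forall k, 2 * r k < 1 + 2 * s) ->
  (\int[P]_w (expR (- s * (\sum_j Z j w ^+ 2) + \sum_k r k * y k w ^+ 2
      + \sum_k a k * y k w))%:E =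
   (\prod_k gauss_mgf (1 + 2 * s - 2 * r k) (a k))%:E)%E.
Proof.
move=> s0; have sg0 : 0 < 1 + 2 * s by rewrite ltr_pwDl// mulr_ge0.
have [n] := ubnP #|[set k | r k != 0]%SET|.
elim: n r a => // n IH r a cr r0 rs.
have [A0|[k]] := set_0Vmem [set k | r k != 0]%SET.
  have {}r0 k : r k = 0.
    by move/setP/(_ k): A0; rewrite !inE => /negbFE/eqP.
  transitivity (\int[P]_w (expR (- s * (\sum_j Z j w ^+ 2) + \sum_k a k * y k w))%:E)%E.
    apply: eq_integral => w _; congr (expR (_ + _))%:E.
    by rewrite [X in _ + X]big1 ?addr0// => k _; rewrite r0 mul0r.
  rewrite integral_exp_normal_vector//; congr EFin; apply: eq_bigr => k _.
  by rewrite r0 mulr0 subr0.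
rewrite inE => rk; set c := Num.sqrt (2 * r k).
pose r' i := if i == k then 0 else r i.
pose a' g i := if i == k then a k + c * g else a i.
pose H w := - s * (\sum_j Z j w ^+ 2) + \sum_i r' i * y i w ^+ 2 + \sum_i a i * y i w.
have mH : measurable_fun setT H.
  apply: measurable_funD; first apply: measurable_funD.
  - by apply: measurable_funM => //; apply: measurable_sum => j; apply: measurable_funX.
  - by apply: measurable_sum => j; apply: measurable_funM => //; apply: measurable_funX.
  - by apply: measurable_sum => j; apply: measurable_funM.
transitivity (\int[P]_w \int[normal_prob 0 1]_g (expR (H w + c * y k w * g))%:E)%E.
  apply: eq_integral => w _; under eq_integral do rewrite expRD EFinM.
  rewrite ge0_integralZl//=; last first.
    by apply/measurable_EFinP; apply: measurableT_comp => //; apply: measurable_funM.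
  rewrite expR_sqr_integral// -EFinM -expRD; congr (expR _)%:E.
  rewrite /H [RHS]addrAC; congr (_ + _); rewrite -[RHS]addrA; congr (_ + _).
  rewrite (bigD1 k)//= [in RHS](bigD1 k)//= /r' eqxx mul0r add0r addrC.
  by congr (_ + _); apply: eq_bigr => i /negPf ->.
rewrite (@fubini_tonelli _ _ _ _ _ P (normal_prob 0 1)
  (fun u => (expR (H u.1 + c * y k u.1 * u.2))%:E)) /=; last 2 first.
- apply/measurable_EFinP; apply: measurableT_comp => //; apply: measurable_funD.
    exact: measurableT_comp.
  apply: measurable_funM => //; apply: measurable_funM => //.
  exact: (measurableT_comp (my k)).
- by move=> u; rewrite lee_fin expR_ge0.
transitivity (\int[normal_prob 0 1]_g
   ((\prod_(i | i != k) gauss_mgf (1 + 2 * s - 2 * r i) (a i))%:E *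
   (gauss_mgf (1 + 2 * s) (a k + c * g))%:E))%E.
  apply: eq_integral => g _.
  transitivity (\int[P]_w (expR (- s * (\sum_j Z j w ^+ 2) +
      \sum_i r' i * y i w ^+ 2 + \sum_i a' g i * y i w))%:E)%E.
    apply: eq_integral => w _; congr (expR _)%:E.
    rewrite /H -!addrA; congr (_ + (_ + _)).
    rewrite (bigD1 k)//= [in RHS](bigD1 k)//= /a' eqxx mulrDl -!addrA; congr (_ + _).
    rewrite addrC; congr (_ + _); first by ring.
    by apply: eq_bigr => i /negPf ->.
  rewrite IH; last 3 first.
  - rewrite (cardsD1 k) inE rk ltnS in cr.
    apply: leq_trans cr; rewrite ltnS; apply: subset_leq_card.
    by apply/fintype.subsetP => i; rewrite !inE /r'; have [->|_ //] := eqVneq i k; rewrite eqxx.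
  - by move=> i; rewrite /r'; case: eqP.
  - by move=> i; rewrite /r'; case: eqP => // _; rewrite mulr0.
  rewrite -EFinM (bigD1 k)//= /r' /a' eqxx mulr0 subr0 mulrC; congr (_ * _)%:E.
  by apply: eq_bigr => i /negPf ->.
rewrite ge0_integralZl//=; last 3 first.
- apply/measurable_EFinP; apply: (measurableT_comp (measurable_gauss_mgf _)).
  by apply: measurable_funD => //; apply: measurable_funM.
- by move=> g _; rewrite lee_fin gauss_mgf_ge0.
- by rewrite lee_fin; apply: prodr_ge0 => i _; exact: gauss_mgf_ge0.
by rewrite integral_gauss_mgf// -EFinM [in RHS](bigD1 k)//= mulrC.
Qed.

Lemma laplace_quadratic_form (t : 'I_p -> R) : (forall k, 0 <= t k) ->
  (\int[P]_w (expR (- \sum_k t k * y k w ^+ 2))%:E =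
   (\prod_k (Num.sqrt (1 + 2 * t k))^-1)%:E)%E.
Proof.
move=> t0; pose s := \sum_k t k.
have ts k : t k <= s by rewrite /s (bigD1 k)//= lerDl sumr_ge0.
have := @integral_exp_quadratic_form s (fun k => s - t k) (fun=> 0).
move=> /(_ (sumr_ge0 _ (fun k _ => t0 k))) h.
transitivity (\prod_k gauss_mgf (1 + 2 * s - 2 * (s - t k)) 0)%:E; last first.
  congr EFin; apply: eq_bigr => k _; rewrite /gauss_mgf expr0n mul0r expR0 mulr1.
  by congr (Num.sqrt _)^-1; ring.
rewrite -h.
- apply: eq_integral => w _; congr (expR _)%:E.
  rewrite [X in _ + _ + X]big1 ?addr0 => [|k _]; last by rewrite mul0r.
  have -> : \sum_j Z j w ^+ 2 = \sum_k y k w ^+ 2.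
    pose u : 'rV_p := \row_j Z j w.
    have yE k : y k w = (u *m O) 0 k.
      by rewrite mxE; apply: eq_bigr => j _; rewrite mxE.
    transitivity ((u *m u^T) 0 0).
      rewrite [RHS]mxE; apply: eq_bigr => j _; rewrite [X in _ * X]mxE.
      by rewrite /u !mxE expr2.
    transitivity (((u *m O) *m (u *m O)^T) 0 0).
      by rewrite trmx_mul mulmxA -[u *m O *m _]mulmxA OO mulmx1.
    rewrite [LHS]mxE; apply: eq_bigr => k _; rewrite yE expr2; congr (_ * _).
    by rewrite [LHS]mxE.
  rewrite mulNr mulr_sumr -sumrN -sumrN -big_split /=; apply: eq_bigr => k _; ring.
- by move=> k; rewrite subr_ge0.
- by move=> k; have := t0 k; lra.
Qed.

End gaussian_vector.

(** * The lower tail of chi-square families *)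

Section laplace_family.
Context d (T : measurableType d) (R : realType) (P : probability T R).
Variables (I : finType) (n : nat) (Q : I -> T -> R).
Hypothesis mQ : forall k, measurable_fun setT (Q k).
Hypothesis laplaceQ : forall t : I -> R, (forall k, 0 <= t k) ->
  (\int[P]_w (expR (- \sum_k t k * Q k w))%:E =
   (\prod_k (Num.sqrt (1 + 2 * t k))^-1 ^+ n)%:E)%E.

Let h : R := (Num.sqrt n%:R)^-1.

(* The expectation of [expR (- i * (Q - n) / sqrt n)] for a chi-square variable [Q]
   with [n] degrees of freedom. *)
Definition chi2_moment (i : nat) : R :=
  expR (i%:R * h * n%:R) * (Num.sqrt (1 + 2 * (i%:R * h)))^-1 ^+ n.

Let u k w := expR (- (Q k w - n%:R) * h).

Let mu_ k : measurable_fun setT (u k).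
Proof.
apply: measurableT_comp => //; apply: measurable_funM => //.
by apply: measurableT_comp => //; apply: measurable_funB.
Qed.

Lemma integral_prod_std_exp (e : I -> nat) :
  (\int[P]_w (\prod_k u k w ^+ e k)%:E = (\prod_k chi2_moment (e k))%:E)%E.
Proof.
have h0 : 0 <= h by rewrite invr_ge0 sqrtr_ge0.
transitivity (\int[P]_w ((\prod_k expR ((e k)%:R * h * n%:R))%:E *
    (expR (- \sum_k (e k)%:R * h * Q k w))%:E))%E.
  apply: eq_integral => w _; rewrite -EFinM; congr EFin.
  rewrite -sumrN expR_sum -big_split /=; apply: eq_bigr => k _.
  rewrite /u -expRM_natl -expRD; congr expR; ring.
rewrite ge0_integralZl//=; last 2 first.
- apply/measurable_EFinP; apply: measurableT_comp => //.
  apply: measurableT_comp => //; apply: measurable_sum => k.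
  exact: measurable_funM.
- by rewrite lee_fin; apply: prodr_ge0 => k _; exact: expR_ge0.
rewrite laplaceQ => [|k]; last by rewrite mulr_ge0.
by rewrite -EFinM -big_split.
Qed.

Lemma integral_prod_exp_polynomial m (c : I -> 'I_m -> R) (e : I -> 'I_m -> nat) :
  (\int[P]_w (\prod_k \sum_a c k a * u k w ^+ e k a)%:E =
   (\prod_k \sum_a c k a * chi2_moment (e k a))%:E)%E.
Proof.
pose F (f : {ffun I -> 'I_m}) w := \prod_k u k w ^+ e k (f k).
have F0 f w : 0 <= F f w by apply: prodr_ge0 => k _; rewrite exprn_ge0 ?expR_ge0.
have mF f : measurable_fun setT (F f).
  by apply: measurable_prod => k _; apply: measurable_funX.
transitivity (\int[P]_w (\sum_(f : {ffun I -> 'I_m}) ((\prod_k c k (f k)) * F f w)%:E)%R)%E.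
  apply: eq_integral => w _; rewrite sumEFin; congr EFin.
  by rewrite bigA_distr_bigA; apply: eq_bigr => f _; rewrite big_split.
have iF f : P.-integrable setT (EFin \o F f).
  apply/integrableP; split; first exact/measurable_EFinP.
  under eq_integral do rewrite /= ger0_norm//.
  by rewrite integral_prod_std_exp ltry.
rewrite integral_sum//; last first.
  move=> f; exact: (integrableZl measurableT (\prod_k c k (f k)) (iF f)).
rewrite bigA_distr_bigA -sumEFin; apply: eq_bigr => f _.
under eq_integral do rewrite EFinM.
have -> : (\prod_k (c k (f k) * chi2_moment (e k (f k))))%:E =
    ((\prod_k c k (f k))%:E * \int[P]_w (F f w)%:E)%E.
  by rewrite integral_prod_std_exp -EFinM big_split.
exact: (integralZl measurableT (iF f)).
Qed.

Lemma measurable_forall_lt (H : {set I}) (x : R) :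
  measurable [set w | forall k, k \in H -> x < Q k w].
Proof.
have -> : [set w | forall k, k \in H -> x < Q k w] =
    \bigcap_(k in [set k | k \in H]) [set w | x < Q k w] by [].
apply: fin_bigcap_measurable => [|k _]; first exact: finite_finset.
rewrite -[X in measurable X]setTI.
exact: (measurable_realfun.measurable_fun_ltr (measurable_cst _) (mQ k)).
Qed.

(* The test function [(1 - eps * (u ^+ t - b)) ^+ 2] is at least [1] for [u ^+ t <= b],
   and has expectation less than [1] when that of [u ^+ t - b] is positive and [eps] small. *)
Lemma lower_tail_prod_le (H : {set I}) (K : R) (t : nat) :
  (0 < n)%N -> 0 <= K -> chi2_moment t >= expR (K * t%:R) + 1 ->
  forall B, chi2_moment (t + t) + expR (K * t%:R) ^+ 2 <= B ->
  (P [set w | forall k, k \in H -> (n%:R - K * Num.sqrt n%:R < Q k w)%R] <=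
   ((1 - B^-1) ^+ #|H|)%:E)%E.
Proof.
move=> n0 K0; set b := expR _ => mt B mtt.
have b0 : 0 < b by exact: expR_gt0.
have mge0 i : 0 <= chi2_moment i.
  by rewrite mulr_ge0 ?expR_ge0// exprn_ge0// invr_ge0 sqrtr_ge0.
have B0 : 0 < B by rewrite (lt_le_trans _ mtt)// ltr_wpDl// exprn_gt0.
pose eps := B^-1; have eps0 : 0 < eps by rewrite invr_gt0.
pose G (x : R) : R := (1 - eps * (x ^+ t - b)) ^+ 2.
pose L : R := (1 + eps * b) ^+ 2 - 2 * eps * (1 + eps * b) * chi2_moment t
  + eps ^+ 2 * chi2_moment (t + t).
have GL (J : {set I}) : (\int[P]_w (\prod_(k in J) G (u k w))%:E = (L ^+ #|J|)%:E)%E.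
  pose c k (a : 'I_3) := if k \in J then
      [:: (1 + eps * b) ^+ 2; - (2 * eps * (1 + eps * b)); eps ^+ 2]`_a
    else (a == ord0)%:R.
  pose e (k : I) (a : 'I_3) := (a * t)%N.
  have e0 : chi2_moment 0 = 1.
    by rewrite /chi2_moment !mul0r mulr0 addr0 expR0 sqrtr1 invr1 expr1n mulr1.
  have -> : L ^+ #|J| = \prod_k \sum_a c k a * chi2_moment (e k a).
    rewrite -prodr_const big_mkcond; apply: eq_bigr => k _.
    rewrite !big_ord_recl big_ord0 /c /e /= /bump /= !addn0 !add1n.
    rewrite mul0n mul1n mul2n -addnn.
    rewrite e0; case: ifP => _ /=; first by rewrite /L; ring.
    by rewrite ?eqxx !(mulr1n, mulr0n, mul1r, mul0r, addr0).
  rewrite -integral_prod_exp_polynomial; apply: eq_integral => w _; congr EFin.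
  rewrite big_mkcond; apply: eq_bigr => k _.
  rewrite !big_ord_recl big_ord0 /c /e /= /bump /= !addn0 !add1n.
  rewrite mul0n mul1n mul2n -addnn exprD expr0; case: ifP => _ /=; first by rewrite /G; ring.
  by rewrite ?eqxx !(mulr1n, mulr0n, mul1r, mul0r, addr0).
have L1 : L <= 1 - B^-1.
  have -> : L = 1 - 2 * eps * (chi2_moment t - b) + eps ^+ 2 *
    (chi2_moment (t + t) - 2 * b * chi2_moment t + b ^+ 2) by rewrite /L; ring.
  have -> : 1 - B^-1 = 1 - 2 * eps * 1 + eps ^+ 2 * B.
    have epsB : eps * B = 1 by rewrite /eps mulVf// gt_eqF.
    have -> : eps ^+ 2 * B = eps by rewrite expr2 -mulrA epsB mulr1.
    by rewrite -[B^-1]/eps; ring.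
  rewrite -!addrA lerD2l lerD//.
    by rewrite lerN2 ler_pM2l ?mulr_gt0// lerBrDl.
  rewrite ler_pM2l ?exprn_gt0//; apply: le_trans mtt.
  by have := mulr_ge0 (ltW b0) (mge0 t); lra.
have mE := measurable_forall_lt H (n%:R - K * Num.sqrt n%:R).
have [A0|[k0 k0H]] := set_0Vmem H.
  by rewrite [in #|H|]A0 cards0 expr0; exact: probability_le1.
have L0 : 0 <= L.
  rewrite -lee_fin -[L]expr1 -(cards1 k0) -GL integral_ge0// => w _.
  by rewrite lee_fin prodr_ge0// => k _; rewrite sqr_ge0.
rewrite (@le_trans _ _ (L ^+ #|H|)%:E)//; last by rewrite lee_fin lerXn2r ?nnegrE// (le_trans L0).
rewrite -GL -[X in P X]setIT -integral_indic//.
apply: ge0_le_integral => //.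
- by apply/measurable_EFinP; exact: measurable_indic.
- apply/measurable_EFinP; under eq_fun do rewrite big_mkcond.
  apply: measurable_prod => k _; case: (k \in H); last exact: measurable_cst.
  apply: measurable_funX; apply: measurable_funB => //; apply: measurable_funM => //.
  by apply: measurable_funB => //; apply: measurable_funX.
- move=> w _; rewrite lee_fin indicE; case: (boolP (w \in _)) => [/set_mem /= hw|_]; last first.
    by apply: prodr_ge0 => k _; exact: sqr_ge0.
  apply: (big_ind (fun x => 1 <= x)) => // [x y|k kH]; first exact: mulr_ege1.
  have hR : 0 < Num.sqrt n%:R :> R by rewrite sqrtr_gt0 ltr0n.
  have ub : u k w ^+ t <= b.
    rewrite /u /b -expRM_natr ler_expR ler_wpM2r//.
    by rewrite /h ler_pdivrMr//; have := hw k kH; lra.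
  rewrite exprn_ege1// lerDl -mulrN mulr_ge0 ?(ltW eps0)// opprB subr_ge0//.
Qed.
End laplace_family.

Lemma chi2_moment_le (R : realType) n i : (0 < n)%N ->
  chi2_moment R n i <= expR (2 * i%:R ^+ 2).
Proof.
move=> n0; rewrite /chi2_moment; set h := (Num.sqrt n%:R)^-1.
have hR : 0 < Num.sqrt n%:R :> R by rewrite sqrtr_gt0 ltr0n.
have h2 : h ^+ 2 * n%:R = 1.
  by rewrite exprVn sqr_sqrtr// mulVf// pnatr_eq0 -lt0n.
set y := 2 * (i%:R * h).
have y0 : 0 <= y by rewrite !mulr_ge0// invr_ge0 ltW.
have y1 : 0 < 1 + y by rewrite ltr_pwDl.
have le1 : (Num.sqrt (1 + y))^-1 <= expR (- (y - y ^+ 2) / 2).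
  rewrite -(@ler_pXn2r _ 2)// ?nnegrE ?expR_ge0 ?invr_ge0 ?sqrtr_ge0//.
  rewrite exprVn sqr_sqrtr ?(ltW y1)// -expRM_natr divfK ?pnatr_eq0//.
  apply: le_trans (expR_ge1Dx _); rewrite -[leLHS]mulr1 ler_pdivrMl//.
  rewrite -subr_ge0 (_ : _ - _ = y ^+ 3); last by ring.
  by rewrite exprn_ge0.
apply: (@le_trans _ _ (expR (i%:R * h * n%:R) * expR (- (y - y ^+ 2) / 2) ^+ n)).
  by rewrite ler_wpM2l ?expR_ge0// lerXn2r ?nnegrE ?expR_ge0 ?invr_ge0 ?sqrtr_ge0.
rewrite -expRM_natr -expRD ler_expR /y.
rewrite [leLHS](_ : _ = 2 * i%:R ^+ 2 * (h ^+ 2 * n%:R)); last by field.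
by rewrite h2 mulr1.
Qed.

Lemma chi2_moment_ge (R : realType) n i : (0 < n)%N -> (i * i <= n)%N ->
  expR (2 / 9 * i%:R ^+ 2) <= chi2_moment R n i.
Proof.
move=> n0 ii; rewrite /chi2_moment; set h := (Num.sqrt n%:R)^-1.
have hR : 0 < Num.sqrt n%:R :> R by rewrite sqrtr_gt0 ltr0n.
have h2 : h ^+ 2 * n%:R = 1.
  by rewrite exprVn sqr_sqrtr// mulVf// pnatr_eq0 -lt0n.
set y := 2 * (i%:R * h).
have y0 : 0 <= y by rewrite !mulr_ge0// invr_ge0 ltW.
have y2 : y <= 2.
  rewrite ler_piMr// ler_pdivrMr// mul1r -(@ler_pXn2r _ 2)// ?nnegrE// ?sqrtr_ge0//.
  by rewrite sqr_sqrtr// expr2 -natrM ler_nat.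
have y1 : 0 < 1 + y by rewrite ltr_pwDl.
set s := Num.sqrt (1 + y); have s0 : 0 < s by rewrite sqrtr_gt0.
have ss : s ^+ 2 = 1 + y by rewrite sqr_sqrtr// ltW.
have s1 : 1 <= s by rewrite -[leLHS]sqrtr1 ler_wsqrtr// lerDl.
have s2 : s <= 2 by rewrite -(@ler_pXn2r _ 2)// ?nnegrE ?(ltW s0)// ss; lra.
have le1 : expR (- (y / 2 - y ^+ 2 / 18)) <= s^-1.
  rewrite expRN lef_pV2 ?posrE ?expR_gt0//.
  apply: (@le_trans _ _ (1 + (s - 1))); first by rewrite addrC subrK.
  apply: le_trans (expR_ge1Dx _) _; rewrite ler_expR.
  have -> : y = (s - 1) * (s + 1) by rewrite -subr_sqr ss; ring.
  have : 0 <= (s - 1) ^+ 2 * (9 - (s + 1) ^+ 2).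
    by rewrite mulr_ge0 ?sqr_ge0// subr_ge0; nra.
  by nra.
apply: (@le_trans _ _ (expR (i%:R * h * n%:R) * expR (- (y / 2 - y ^+ 2 / 18)) ^+ n)); last first.
  by rewrite ler_wpM2l ?expR_ge0// lerXn2r ?nnegrE ?expR_ge0 ?invr_ge0 ?sqrtr_ge0.
rewrite -expRM_natr -expRD ler_expR /y.
rewrite [leRHS](_ : _ = 2 / 9 * i%:R ^+ 2 * (h ^+ 2 * n%:R)); last by field.
by rewrite h2 mulr1.
Qed.

Lemma chi2_moment_eventually (R : realType) (K : R) : 0 <= K ->
  exists t N B, 1 < B /\ forall n, (N <= n)%N ->
    [/\ (0 < n)%N, expR (K * t%:R) + 1 <= chi2_moment R n t
      & chi2_moment R n (t + t) + expR (K * t%:R) ^+ 2 <= B].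
Proof.
move=> K0; pose t := (Num.truncn (9 / 2 * (K + 1))).+1.
have tK : 9 / 2 * (K + 1) < t%:R by exact: truncnS_gt.
have t1 : 1 <= t%:R :> R by rewrite ler1n.
exists t, (t * t)%N, (expR (8 * t%:R ^+ 2) + expR (K * t%:R) ^+ 2); split.
  by rewrite ltr_pwDr ?exprn_gt0 ?expR_gt0// -expR0 ler_expR mulr_ge0// sqr_ge0.
move=> n tn; have n0 : (0 < n)%N by rewrite (leq_trans _ tn).
split=> //.
  apply: le_trans (chi2_moment_ge R n0 tn).
  apply: (@le_trans _ _ (expR (K * t%:R + 1))); last first.
    by rewrite ler_expR; nra.
  have b1 : 1 <= expR (K * t%:R) by rewrite -expR0 ler_expR mulr_ge0.
  have e2 : 2 <= expR 1 :> R by apply: le_trans (expR_ge1Dx 1); lra.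
  by rewrite expRD; nra.
rewrite lerD2r; apply: le_trans (chi2_moment_le _ _ n0) _.
by rewrite ler_expR natrD; lra.
Qed.

(** * The smallest sample eigenvalue *)

Section sample.
Context d (T : measurableType d) (R : realType) (P : probability T R).
Variables (n p : nat) (mu : 'cV[R]_p) (Sigma : 'M[R]_p) (X : 'I_n -> {RV P >-> p.-tuple R}).
Hypothesis normX : forall i, is_normal_vector mu Sigma (X i).
Hypothesis indX : mutually_independent X.
Variables (V : 'M[R]_p) (lam : 'I_p -> R).
Hypothesis VV : V *m V^T = 1%:M.
Hypothesis SigmaO : Sigma *m V = V *m diag_mx (\row_k lam k).
Hypothesis lam0 : forall k, 0 < lam k.

Definition score k (x : p.-tuple R) : R :=
  ((col k V)^T *m (colvec x - mu)) 0 0.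

Definition chi2_score k w := (lam k)^-1 * \sum_i score k (X i w) ^+ 2.

Lemma measurable_score k : measurable_fun setT (score k).
Proof.
rewrite (_ : score k = fun x => \sum_j V j k * (tnth x j - mu j 0)).
  apply: measurable_sum => j; apply: measurable_funM => //.
  by apply: measurable_funB => //; exact: measurable_tnth.
by apply/funext => x; rewrite /score mxE; apply: eq_bigr => j _; rewrite !mxE.
Qed.

Lemma measurable_chi2_score k : measurable_fun setT (chi2_score k).
Proof.
apply: measurable_funM => //; apply: measurable_sum => i; apply: measurable_funX.
by apply: (measurableT_comp (measurable_score k)).
Qed.

Lemma Sigma_col k : Sigma *m col k V = lam k *: col k V.
Proof.
apply/colP => i; have := congr1 (fun M : 'M[R]_p => M i k) SigmaO.
rewrite mul_mx_diag !mxE mulrC => <-.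
by apply: eq_bigr => j _; rewrite mxE.
Qed.

Lemma laplace_chi2_score (t : 'I_p -> R) : (forall k, 0 <= t k) ->
  (\int[P]_w (expR (- \sum_k t k * chi2_score k w))%:E =
   (\prod_k (Num.sqrt (1 + 2 * t k))^-1 ^+ n)%:E)%E.
Proof.
move=> t0; pose f (x : p.-tuple R) := expR (- \sum_k t k * ((lam k)^-1 * score k x ^+ 2)).
have mf : measurable_fun setT f.
  apply: measurableT_comp => //; apply: measurableT_comp => //.
  apply: measurable_sum => k; apply: measurable_funM => //; apply: measurable_funM => //.
  by apply: measurable_funX; exact: measurable_score.
have f0 x : 0 <= f x by exact: expR_ge0.
transitivity (\int[P]_w (\prod_i f (X i w))%:E)%E.
  apply: eq_integral => w _; congr EFin; rewrite -expR_sum; congr expR.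
  rewrite -sumrN [RHS](eq_bigr (fun i => \sum_k - (t k * ((lam k)^-1 * score k (X i w) ^+ 2)))).
    rewrite exchange_big /=; apply: eq_bigr => k _.
    by rewrite sumrN -!mulr_sumr.
  by move=> i _; rewrite sumrN.
rewrite (mutually_independent_prod (e := fun=> \prod_k (Num.sqrt (1 + 2 * t k))^-1)
  indX (fun=> mf) (fun=> f0)).
  by rewrite prodr_const card_ord prodrXl.
move=> i; have [A [Z [[[symA pA] AA] indZ normZ XE]]] := normX i.
rewrite -(laplace_quadratic_form indZ normZ VV t0).
apply: eq_integral => w _; congr (expR (- _))%:E; apply: eq_bigr => k _.
have -> : score k (X i w) = Num.sqrt (lam k) * \sum_j Z j w * V j k.
  rewrite /score XE addrC addKr mulmxA.
  have -> : (col k V)^T *m A = Num.sqrt (lam k) *: (col k V)^T.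
    rewrite -{1}symA -trmx_mul (@posdef_sqrt_eigenvector _ _ A (lam k))// ?ltW//.
      by rewrite linearZ.
    by rewrite AA Sigma_col.
  rewrite -scalemxAl mxE; congr (_ * _); rewrite mxE; apply: eq_bigr => j _.
  by rewrite !mxE mulrC.
by rewrite exprMn sqr_sqrtr ?ltW// mulKf// gt_eqF.
Qed.

End sample.

Lemma orthogonal_col_norm (R : comUnitRingType) p (V : 'M[R]_p) k :
  V *m V^T = 1%:M -> (col k V)^T *m col k V = 1%:M.
Proof.
move=> /mulmx1C VtV; apply/matrixP => i j; rewrite !ord1 mxE.
have := congr1 (fun M : 'M[R]_p => M k k) VtV; rewrite !mxE !eqxx => <-.
by apply: eq_bigr => a _; rewrite !mxE.
Qed.

Lemma posdef_eigenvalue_gt0 (R : realType) p (Sigma V : 'M[R]_p) (lam : 'I_p -> R) k :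
  posdef Sigma -> V *m V^T = 1%:M -> Sigma *m V = V *m diag_mx (\row_k lam k) ->
  0 < lam k.
Proof.
move=> [_ pS] VV SO; have vv := orthogonal_col_norm k VV.
have v0 : col k V != 0.
  by apply: contra_eqN vv => /eqP ->; rewrite mulmx0 eq_sym matrix_nonzero1.
have := pS _ v0; rewrite -mulmxA (Sigma_col SO) -scalemxAr vv !mxE.
by rewrite eqxx mulr1.
Qed.

Lemma sample_covE (R : realType) n p (x : 'I_n -> 'cV[R]_p) i j :
  sample_cov x i j = n%:R^-1 * \sum_a
    (x a i 0 - n%:R^-1 * \sum_b x b i 0) * (x a j 0 - n%:R^-1 * \sum_b x b j 0).
Proof.
rewrite mxE summxE; congr (_ * _); apply: eq_bigr => a _.
by rewrite mxE big_ord1 !mxE !summxE.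
Qed.

Lemma measurable_sample_cov d (T : measurableType d) (R : realType)
    (P : probability T R) n p (X : 'I_n -> {RV P >-> p.-tuple R}) i j :
  measurable_fun setT (fun w => sample_cov (fun a => colvec (X a w)) i j).
Proof.
have mX a k : measurable_fun setT (fun w => colvec (X a w) k 0).
  under eq_fun do rewrite mxE.
  by apply: (measurableT_comp (measurable_tnth k)).
under eq_fun do rewrite sample_covE.
by apply: measurable_funM => //; apply: measurable_sum => a; apply: measurable_funM;
  apply: measurable_funB => //; apply: measurable_funM => //; apply: measurable_sum.
Qed.

Lemma prob_min_eigenvalue_ge d (T : measurableType d) (R : realType)
    (P : probability T R) n p (mu : 'cV[R]_p.+1) (Sigma : 'M[R]_p.+1)
    (X : 'I_n -> {RV P >-> p.+1.-tuple R}) (lam : seq R) (l : T -> seq R)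
    (H : {set 'I_p.+1}) (K B : R) (t : nat) :
  posdef Sigma -> (forall i, is_normal_vector mu Sigma (X i)) ->
  mutually_independent X -> is_spectrum Sigma lam ->
  (forall w, is_spectrum (sample_cov (fun i => colvec (X i w))) (l w)) ->
  (0 < n)%N -> 0 <= K -> expR (K * t%:R) + 1 <= chi2_moment R n t ->
  chi2_moment R n (t + t) + expR (K * t%:R) ^+ 2 <= B ->
  (forall k, k \in H -> lam`_k * (1 - K / Num.sqrt n%:R) <= lam`_p) ->
  measurable [set w | (l w)`_p <= lam`_p] /\
  ((1 - (1 - B^-1) ^+ #|H|)%:E <= P [set w | ((l w)`_p <= lam`_p)%R])%E.
Proof.
move=> pS normX indX [_ cS] lS n0 K0 mt mtt HK.
have [symS _] := pS.
have [V VV SO] := symmetric_diagonalizable symS cS.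
have lam0 k := posdef_eigenvalue_gt0 k pS VV SO.
have mE : measurable [set w | (l w)`_p <= lam`_p].
  by apply: measurable_min_eigenvalue_le lS => i j; exact: measurable_sample_cov.
split=> //.
have := @lower_tail_prod_le _ _ _ P _ _ _ (measurable_chi2_score mu X V (fun k => lam`_k))
  (laplace_chi2_score normX indX VV SO lam0) H K t n0 K0 mt B mtt.
set bad := [set w | _] => Pbad.
rewrite -[X in P X]setCK probability_setC; last exact: measurableC.
rewrite EFinB leeB//.
apply: le_trans Pbad; apply: le_measure; rewrite ?inE; first exact: measurableC.
  exact: (measurable_forall_lt (measurable_chi2_score mu X V (fun k => lam`_k))).
move=> w /= lw k kH; rewrite ltNge; apply/negP => Qk; apply: lw.
pose v := (col k V)^T.
have vv : v *m v^T = 1%:M by rewrite trmxK orthogonal_col_norm.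
have [ss cl] := lS w.
apply: le_trans (min_eigenvalue_le (sample_cov_sym _) ss cl vv) _.
apply: le_trans (sample_cov_form_le _ _ mu) _; apply: le_trans (HK k kH).
have sE : \sum_i (v *m (colvec (X i w) - mu)) 0 0 ^+ 2 =
    lam`_k * chi2_score mu X V (fun k => lam`_k) k w.
  by rewrite /chi2_score mulrA divff ?mul1r// gt_eqF.
rewrite sE mulrCA ler_wpM2l ?(ltW (lam0 k))//.
have hR : 0 < Num.sqrt n%:R :> R by rewrite sqrtr_gt0 ltr0n.
have -> : K / Num.sqrt n%:R = n%:R^-1 * (K * Num.sqrt n%:R).
  by rewrite -{2}(@sqr_sqrtr _ n%:R)//; field; rewrite gt_eqF.
have -> : 1 - n%:R^-1 * (K * Num.sqrt n%:R) = n%:R^-1 * (n%:R - K * Num.sqrt n%:R).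
  by rewrite mulrBr mulVf// pnatr_eq0 -lt0n.
by rewrite ler_wpM2l// invr_ge0.
Qed.

Lemma sample_sizeE (R : realType) (q : R) p : admissible q p ->
  (sample_size q p)%:R = p%:R / q.
Proof. by move=> [_ pq]; rewrite /sample_size truncnK. Qed.

Lemma prob_min_eigenvalue_eventually (R : realType) (q : R) (hq : 0 < q < 1)
    (d : nat -> measure_display) (Omega : forall p, measurableType (d p))
    (P : forall p, probability (Omega p) R)
    (mu : forall p, 'cV[R]_p) (Sigma : forall p, 'M[R]_p)
    (hSigma : forall p, (0 < p)%N -> posdef (Sigma p))
    (X : forall p, 'I_(sample_size q p) -> {RV (P p) >-> p.-tuple R})
    (hXnormal : forall p, admissible q p ->
       forall i, is_normal_vector (mu p) (Sigma p) (X p i))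
    (hXindep : forall p, admissible q p -> mutually_independent (X p))
    (lam : nat -> seq R)
    (hlam : forall p, (0 < p)%N -> is_spectrum (Sigma p) (lam p))
    (l : forall p, Omega p -> seq R)
    (hl : forall p, admissible q p -> forall w,
       is_spectrum (sample_cov (fun i => colvec (X p i w))) (l p w))
    (kappa : R) : 0 < kappa ->
  exists2 c : R, 0 < c & exists N, forall p, (N <= p)%N -> admissible q p ->
    measurable [set w | (l p w)`_p.-1 <= (lam p)`_p.-1] /\
    ((1 - expR (- c * (xi lam kappa p)%:R))%:E <=
     P p [set w | ((l p w)`_p.-1 <= (lam p)`_p.-1)%R])%E.
Proof.
move=> k0; have /andP[q0 q1] := hq.
have sq0 : 0 < Num.sqrt q by rewrite sqrtr_gt0.
pose K := kappa / Num.sqrt q; have K0 : 0 <= K by rewrite divr_ge0// ltW.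
have [t [N [B [B1 HN]]]] := chi2_moment_eventually K0.
have rho0 : 0 < 1 - B^-1 by rewrite subr_gt0 invf_lt1// (lt_trans _ B1).
have rho1 : 1 - B^-1 < 1 by rewrite ltrBlDr ltrDl invr_gt0 (lt_trans _ B1).
exists (- ln (1 - B^-1)); first by rewrite oppr_gt0 ln_lt0// rho0.
exists N => p Np ap; have [p0 _] := ap.
have nE := sample_sizeE ap.
have pn : (N <= sample_size q p)%N.
  rewrite (leq_trans Np)// -(ler_nat R) nE ler_pdivlMr// ler_piMr// ltW//.
have [n0 mt mtt] := HN _ pn.
rewrite opprK expRM_natr lnK ?posrE// /xi.
move: p p0 ap nE pn n0 mt mtt {Np} => [//|p] _ ap nE _ n0 mt mtt /=.
apply: (prob_min_eigenvalue_ge (hSigma _ _) (hXnormal _ ap) (hXindep _ ap) (hlam _ _)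
  (hl _ ap) n0 K0 mt mtt) => // k.
rewrite inE => /asboolP/(_ p.+1 (leqnn _)).
have [V VV SO] : exists2 V : 'M[R]_p.+1, V *m V^T = 1%:M &
    Sigma p.+1 *m V = V *m diag_mx (\row_i (lam p.+1)`_i).
  have [_ cS] := hlam p.+1 isT; have [symS _] := hSigma p.+1 isT.
  exact: symmetric_diagonalizable.
have lam0 := posdef_eigenvalue_gt0 k (hSigma _ _) VV SO.
rewrite ltr_distl => /andP[h _].
have -> : K / Num.sqrt (sample_size q p.+1)%:R = kappa / Num.sqrt p.+1%:R.
  rewrite nE sqrtrM// sqrtrV ?(ltW q0)// /K -mulrA; congr (_ * _).
  by rewrite invfM invrK mulrCA mulVf ?mulr1// gt_eqF.
rewrite mulrC -ler_pdivlMr ?lam0//.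
exact: ltW.
Qed.

Lemma limf_einf_within_ge (R : realType) (D : set nat) (g : nat -> \bar R) (f : nat -> R) N :
  (forall p, 0 <= f p <= 1) ->
  (forall p, (N <= p)%N -> D p -> ((1 - f p)%:E <= g p)%E) ->
  (1 - limn_esup (EFin \o f) <= limf_einf g (within D \oo))%E.
Proof.
move=> f01 fg; rewrite limf_einfE; set y := ereal_sup _.
rewrite /limn_esup limf_esupE; set L := ereal_inf _.
have key V : \oo V -> (1 - ereal_sup [set (f x)%:E | x in V] <= y)%E.
  move=> [M _ MV]; pose W := V `&` [set p | (N <= p)%N].
  apply: (@le_trans _ _ (ereal_inf (g @` (W `&` D)))); last first.
    apply: ereal_sup_ubound; exists (W `&` D) => //.
    rewrite /within /=; exists (maxn M N) => // p /=; rewrite geq_max => /andP[Mp Np] Dp.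
    by split=> //; split=> //; exact: MV.
  apply: le_ereal_inf_tmp => _ [p [[Vp Np] Dp] <-].
  apply: le_trans (fg p Np Dp); rewrite EFinB leeB//.
  by apply: ereal_sup_ubound; exists p.
have sup_fin V : \oo V -> exists2 r, r <= 1 & ereal_sup [set (f x)%:E | x in V] = r%:E.
  move=> [M _ MV]; set s := ereal_sup _.
  have s1 : (s <= 1)%E.
    by apply: ge_ereal_sup => _ [x _ <-]; rewrite lee_fin; case/andP: (f01 x).
  have s0 : (0 <= s)%E.
    apply: (@le_trans _ _ (f M)%:E); first by rewrite lee_fin; case/andP: (f01 M).
    by apply: ereal_sup_ubound; exists M => //; apply: MV => /=.
  by case: s s0 s1 => // r _; rewrite lee_fin => r1; exists r.
have fT : \oo [set: nat] by exact: filterT.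
have [r r1 sE] := sup_fin setT fT.
have := key setT fT; rewrite sE => yr.
case: y key yr => [y| |] key yr; [|by rewrite leey|by []].
have yL : ((1 - y)%:E <= L)%E.
  apply: le_ereal_inf_tmp => _ [V FV <-]; have := key V FV.
  have [r' _ ->] := sup_fin V FV; rewrite -EFinB !lee_fin; lra.
have Lr : (L <= r%:E)%E by rewrite -sE; apply: ereal_inf_lbound; exists setT.
by case: L yL Lr => // L; rewrite -EFinB !lee_fin => yL _; lra.
Qed.

Theorem mainTheorem2 (R : realType) (q : R) (hq : 0 < q < 1)
    (d : nat -> measure_display) (Omega : forall p, measurableType (d p))
    (P : forall p, probability (Omega p) R)
    (mu : forall p, 'cV[R]_p) (Sigma : forall p, 'M[R]_p)
    (hSigma : forall p, (0 < p)%N -> posdef (Sigma p))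
    (X : forall p, 'I_(sample_size q p) -> {RV (P p) >-> p.-tuple R})
    (hXnormal : forall p, admissible q p ->
       forall i, is_normal_vector (mu p) (Sigma p) (X p i))
    (hXindep : forall p, admissible q p -> mutually_independent (X p))
    (lam : nat -> seq R)
    (hlam : forall p, (0 < p)%N -> is_spectrum (Sigma p) (lam p))
    (l : forall p, Omega p -> seq R)
    (hl : forall p, admissible q p -> forall w,
       is_spectrum (sample_cov (fun i => colvec (X p i w))) (l p w)) :
  (forall kappa : R, 0 < kappa < Num.sqrt (2 / pi) ->
     exists c : R, 0 < c /\
       (limf_einf (fun p => P p [set w | ((l p w)`_p.-1 <= (lam p)`_p.-1)%R])
                  (within (admissible q) \oo)
        >= 1 - limn_esup (fun p => (expR (- c * (xi lam kappa p)%:R))%:E))%E)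
  /\
  (forall kappa : R, 0 < kappa < Num.sqrt (2 / pi) ->
     xi lam kappa p @[p --> \oo] --> \oo ->
     P p [set w | (l p w)`_p.-1 <= (lam p)`_p.-1]
       @[p --> within (admissible q) \oo] --> 1%E).
Proof.
split=> kappa /andP[kappa0 _].
  have [c c0 [N HN]] := prob_min_eigenvalue_eventually hq hSigma hXnormal hXindep hlam hl kappa0.
  exists c; split=> //.
  apply: (@limf_einf_within_ge _ _ _ (fun p => expR (- c * (xi lam kappa p)%:R)) N).
    move=> p; rewrite expR_ge0 /= -expR0 ler_expR mulNr oppr_le0.
    by rewrite mulr_ge0// ltW.
  by move=> p Np ap; have [] := HN p Np ap.
move=> xioo.
have [c c0 [N HN]] := prob_min_eigenvalue_eventually hq hSigma hXnormal hXindep hlam hl kappa0.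
have cvg0 : expR (- c * (xi lam kappa p)%:R) @[p --> \oo] --> (0 : R).
  under eq_fun do rewrite expRM_natr.
  apply: (cvg_comp _ _ xioo); apply: cvg_expr.
  by rewrite ger0_norm ?expR_ge0// -[ltRHS]expR0 ltr_expR oppr_lt0.
have lb1 : (1 - expR (- c * (xi lam kappa p)%:R))%:E @[p --> \oo] --> 1%E.
  apply: cvg_EFin; first exact: nearW.
  by rewrite -[X in _ --> X]subr0; apply: cvgB => //; exact: cvg_cst.
apply: (@squeeze_cvge _ _ _ _ (fun p => (1 - expR (- c * (xi lam kappa p)%:R))%:E) _ (cst 1%E)).
- exists N => // p /= Np ap; have [mE ->] := HN p Np ap.
  exact: probability_le1.
- exact: cvg_within_filter.
- exact: cvg_cst.
Qed.
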